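(* Let $z_1=(x_1,y_1)$ and $z_2=(x_2,y_2)$ be distinct points of $\mathbb{Z}^2$ with $x_2\ge x_1$ and $y_2\ge y_1$, so that $d(z_1,z_2)=(x_2-x_1)+(y_2-y_1)$. Let $d\ge d(z_1,z_2)$ be an integer, $c=d-d(z_1,z_2)$, and let ${\cal A}_d(z_1,z_2)$ be the optimal tristance anticode in ${\cal G}_2$ of diameter $d$ centered about $z_1$ and $z_2$. Then ${\cal A}_d(z_1,z_2)$ consists of all $(x,y)\in\mathbb{Z}^2$ such that $x_1-c\le x\le x_2+c$, $y_1-c\le y\le y_2+c$, $x_1+y_1-c\le x+y\le x_2+y_2+c$, and $x_1-y_2-c\le x-y\le x_2-y_1+c$.
   Context: The grid graph ${\cal G}_2$ has vertex set $\mathbb{Z}^2$, with $z,z'$ adjacent iff their $L_1$-distance $d(z,z')$ is $1$. For $z_1,z_2,z_3\in\mathbb{Z}^2$, the tristance $d_3(z_1,z_2,z_3)$ is the minimum number of edges of a tree in ${\cal G}_2$ (possibly using additional vertices) containing $z_1,z_2,z_3$. A set ${\cal A}\subset\mathbb{Z}^2$ is a tristance anticode of diameter $d$ centered about $z_1$ and $z_2$ if $d_3(z_1,z_2,z)\le d$ for all $z\in{\cal A}$; it is optimal if it has the largest possible cardinality among such sets. *)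

(* Defs.v *)
From mathcomp Require Import all_boot all_order all_algebra finmap zify.
From mathcomp Require Import boolp classical_sets functions cardinality.

Set Implicit Arguments.
Unset Strict Implicit.
Unset Printing Implicit Defensive.

Import Order.TTheory GRing.Theory Num.Theory.
Local Open Scope ring_scope.

Notation vertex := (int * int)%type.

Definition l1dist (z z' : vertex) : int := `|z.1 - z'.1| + `|z.2 - z'.2|.

Definition grid_adj (z z' : vertex) : bool := l1dist z z' == 1.

(* A finite subgraph is a pair (V, E) where every element of E is the
   unordered pair {u, v} of its two endpoints. *)
Definition edge_rel (E : {fset {fset vertex}}) : rel vertex :=
  fun u v => ([fset u; v] \in E)%fset.

Definition grid_subgraph (V : {fset vertex}) (E : {fset {fset vertex}}) : Prop :=
  forall e, e \in E ->
    exists u v, [/\ u \in V, v \in V, grid_adj u v & e = [fset u; v]%fset].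

Definition connected_graph (V : {fset vertex}) (E : {fset {fset vertex}}) : Prop :=
  forall u v, u \in V -> v \in V ->
    exists2 p : seq vertex, path (edge_rel E) u p & last u p = v.

(* Cycles of length 2 traverse one edge back and forth, hence the bound. *)
Definition acyclic_graph (E : {fset {fset vertex}}) : Prop :=
  forall c : seq vertex, (2 < size c)%N -> ~ ucycle (edge_rel E) c.

Definition grid_tree (V : {fset vertex}) (E : {fset {fset vertex}}) : Prop :=
  [/\ grid_subgraph V E, connected_graph V E & acyclic_graph E].

Definition spanned_by (z1 z2 z3 : vertex) (n : nat) : Prop :=
  exists V E, [/\ grid_tree V E, z1 \in V, z2 \in V, z3 \in V & #|` E|%fset = n].

Lemma grid_tree1 (z : vertex) : grid_tree [fset z]%fset fset0.
Proof.
split=> [e|u v|[|x [|y c]] //= _].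
- by rewrite in_fset0.
- by rewrite !in_fset1 => /eqP -> /eqP ->; exists [::].
Qed.

Lemma edge_relC E : symmetric (edge_rel E).
Proof.
move=> u v; rewrite /edge_rel; congr (_ \in E).
by apply/fsetP=> x; rewrite !in_fset2 orbC.
Qed.

Lemma grid_tree_extend V E (u v : vertex) :
  grid_tree V E -> u \in V -> grid_adj u v ->
  exists V' E', [/\ grid_tree V' E', {subset V <= V'} & v \in V'].
Proof.
move=> tG; have [sG cG aG] := tG; move=> uV uv; have [vV|vV] := boolP (v \in V); first by exists V, E; split.
have nuv : u != v by apply: contraNneq vV => <-.
exists (v |` V)%fset, ([fset u; v] |` E)%fset; split; last 2 first.
- by move=> x xV; rewrite in_fset1U xV orbT.
- by rewrite in_fset1U eqxx.
set E' := ([fset u; v] |` E)%fset.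
have EE' x y : edge_rel E x y -> edge_rel E' x y.
  by rewrite /edge_rel /E' in_fset1U => ->; rewrite orbT.
have uvE' : edge_rel E' u v by rewrite /edge_rel /E' in_fset1U eqxx.
have E'v a : edge_rel E' v a -> a = u.
  rewrite /edge_rel /E' in_fset1U => /orP[/eqP /fsetP /(_ u)|].
    by rewrite !in_fset2 eqxx /= (negbTE nuv) /= => /eqP.
  case/sG=> [x [y [xV yV _ /fsetP /(_ v)]]].
  rewrite !in_fset2 eqxx /= => /esym/orP[]/eqP vx.
    by rewrite vx xV in vV.
  by rewrite vx yV in vV.
have E'E x y : x != v -> y != v -> edge_rel E' x y -> edge_rel E x y.
  move=> xv yv; rewrite {1}/edge_rel /E' in_fset1U => /orP[/eqP/fsetP/(_ v)|//].
  by rewrite !in_fset2 eqxx orbT ![v == _]eq_sym (negbTE xv) (negbTE yv).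
split.
- move=> e; rewrite /E' in_fset1U => /orP[/eqP ->|/sG[x [y [xV yV xy ->]]]].
    by exists u, v; rewrite !in_fset1U eqxx uV orbT.
  by exists x, y; rewrite !in_fset1U xV yV !orbT.
- have cu w : w \in (v |` V)%fset ->
      (exists2 p, path (edge_rel E') u p & last u p = w) /\
      (exists2 p, path (edge_rel E') w p & last w p = u).
    rewrite in_fset1U => /orP[/eqP ->|wV].
      split; first by exists [:: v]; rewrite //= uvE'.
      by exists [:: u]; rewrite //= edge_relC uvE'.
    have [p pp lp] := cG u w uV wV; have [q pq lq] := cG w u wV uV.
    split; [exists p|exists q] => //; exact: sub_path EE' _ _ _.
  move=> a b /cu[_ [p pp lp]] /cu[[q pq lq] _].
  by exists (p ++ q); rewrite ?cat_path ?last_cat ?pp lp.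
- move=> c sc /andP[cc uc]; have [vc|vc] := boolP (v \in c); last first.
    apply: (aG c sc); rewrite /ucycle uc andbT.
    apply: (sub_in_cycle (P := predC1 v)) cc; first by move=> x y; apply: E'E.
    by apply/allP=> x xc /=; apply: contraNneq vc => <-.
  have [i s rs] := rot_to vc.
  move: cc uc sc; rewrite -(rot_cycle i) -(rot_uniq i) -(size_rot i) rs.
  case: s {rs} => [|a s] //=; case: (lastP s) => [|t b] //=.
  rewrite rcons_path => /andP[/E'v -> /andP[_]].
  rewrite last_rcons edge_relC => /E'v ->.
  by rewrite mem_rcons in_cons eqxx /= andbF.
Qed.

Lemma grid_tree_reach V E (u v : vertex) :
  grid_tree V E -> u \in V ->
  exists V' E', [/\ grid_tree V' E', {subset V <= V'} & v \in V'].
Proof.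
case: v => x' y'.
have [n] := ubnPleq (`|(u.1 - x')%R| + `|(u.2 - y')%R|)%N.
elim: n V E u => [|n IH] V E [x y] /= le tVE uV.
  have -> : (x', y') = (x, y) by congr pair; lia.
  by exists V, E; split.
have step w : grid_adj (x, y) w ->
    (absz (w.1 - x')%R + absz (w.2 - y')%R <= n)%N ->
    exists V' E', [/\ grid_tree V' E', {subset V <= V'} & (x', y') \in V'].
  move=> aw lw; have [V1 [E1 [t1 s1 w1]]] := grid_tree_extend tVE uV aw.
  have [V2 [E2 [t2 s2 w2]]] := IH V1 E1 w lw t1 w1.
  by exists V2, E2; split=> // z /s1 /s2.
have [xx'|xx'|xx'] := ltgtP x x'.
- by apply: (step (x + 1, y)); rewrite /grid_adj /l1dist /=; lia.
- by apply: (step (x - 1, y)); rewrite /grid_adj /l1dist /=; lia.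
have [yy'|yy'|yy'] := ltgtP y y'.
- by apply: (step (x, y + 1)); rewrite /grid_adj /l1dist /=; lia.
- by apply: (step (x, y - 1)); rewrite /grid_adj /l1dist /=; lia.
by exists V, E; split=> //; rewrite -xx' -yy'.
Qed.

Lemma spanned_by_ex (z1 z2 z3 : vertex) : exists n, `[< spanned_by z1 z2 z3 n >].
Proof.
have [V [E [t s h2]]] := grid_tree_reach z2 (grid_tree1 z1) (fset11 z1).
have [V' [E' [t' s' h3]]] := grid_tree_reach z3 t h2.
exists #|` E'|%fset; apply/asboolP; exists V', E'; split=> //; first exact/s'/s/fset1P.
exact: s'.
Qed.

Definition tristance (z1 z2 z3 : vertex) : nat := ex_minn (spanned_by_ex z1 z2 z3).

Definition tristance_anticode (z1 z2 : vertex) (d : int) (A : set vertex) : Prop :=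
  forall z, A z -> (tristance z1 z2 z)%:Z <= d.

Definition optimal_anticode (z1 z2 : vertex) (d : int) (A : set vertex) : Prop :=
  tristance_anticode z1 z2 d A /\
  forall B, tristance_anticode z1 z2 d B -> (B #<= A)%card.

(* Main.v *)
(* The tristance is half the perimeter of the bounding box of the three points.
   Joining each point to the coordinatewise median [m] gives a tree with at most
   that many edges. Conversely, a connected subgraph containing the three points
   crosses every vertical and every horizontal line between two consecutive
   columns or rows of the box, each time along a different edge. So the tristance
   of z1, z2, z is d(z1, z2) plus the L1-distance from z to the box of z1, z2, and
   the points where it is at most d form a finite set, given by the listed
   inequalities; this set is the largest anticode, hence the only optimal one. *)
Require Import Defs.
From mathcomp Require Import all_boot all_order all_algebra finmap zify.
From mathcomp Require Import boolp classical_sets functions cardinality.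
Import Order.TTheory GRing.Theory Num.Theory.
Local Open Scope ring_scope.
Local Open Scope classical_set_scope.

Lemma fset2_inj {T : choiceType} {a b a' b' : T} :
  [fset a; b]%fset = [fset a'; b']%fset ->
  (a = a' /\ b = b') \/ (a = b' /\ b = a').
Proof.
move=> /fsetP ab; move: (ab a) (ab b) (ab a') (ab b').
rewrite !in_fset2 !eqxx !orbT /= => /esym/orP[]/eqP-> /esym/orP[]/eqP->.
- by rewrite eqxx !orbb => _ /eqP ->; left.
- by left.
- by right.
- by rewrite eqxx !orbb => /eqP -> _; left.
Qed.

(* In a cycle through [v], its two neighbours are distinct, but [u] is the only
   neighbour of [v]. *)
Lemma grid_tree_leaf V E u v :
  grid_tree V E -> u \in V -> v \notin V -> grid_adj u v ->
  grid_tree (v |` V)%fset ([fset u; v] |` E)%fset.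
Proof.
move=> [subE conE acyE] uV vV adj_uv; set E' := ([fset u; v] |` E)%fset.
have subE' x y : edge_rel E x y -> edge_rel E' x y by apply: fset1Ur.
have uvE' : edge_rel E' u v by exact: fset1U1.
have E_V x y : edge_rel E x y -> x \in V /\ y \in V.
  by move=> /subE[a [b [aV bV _ /fset2_inj[[-> ->]|[-> ->]]]]].
have E'P x y : edge_rel E' x y ->
    [\/ edge_rel E x y, x = u /\ y = v | x = v /\ y = u].
  move=> /fset1UP[/fset2_inj[]|xyE]; first by constructor 2.
    by constructor 3.
  by constructor 1.
have v_nbr x : edge_rel E' v x -> x = u.
  by case/E'P=> [/E_V[]|[]|[]] //; [rewrite (negPf vV) | move=> ->].
split=> [e /fset1UP[->|/subE[a [b [aV bV ab ->]]]]|x y|c size_c /andP[cyc uniq_c]].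
- by exists u, v; rewrite fset1U1 fset1Ur.
- by exists a, b; rewrite !fset1Ur.
- have conE' s t : s \in V -> t \in V ->
      exists2 p, path (edge_rel E') s p & last s p = t.
    move=> sV tV; have [p pE <-] := conE s t sV tV.
    by exists p => //; apply: sub_path pE.
  move=> /fset1UP[->|xV] /fset1UP[->|yV].
  + by exists [::].
  + have [p pE lp] := conE' u y uV yV.
    by exists (u :: p); rewrite //= edge_relC uvE'.
  + have [p pE lp] := conE' x u xV uV.
    by exists (rcons p v); rewrite ?last_rcons // rcons_path pE lp.
  + exact: conE'.
have [vc|vc] := boolP (v \in c).
  (* Rotated to start at [v], the cycle has the neighbours of [v] as its second and last entries. *)
  have [i s rot_c] := rot_to vc; move: cyc uniq_c size_c.
  rewrite -(rot_cycle i) -(rot_uniq i) -(size_rot i) rot_c.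
  case: s {rot_c} => [|a [|b t]] //= /and3P[/v_nbr-> _].
  rewrite rcons_path edge_relC => /andP[_ /v_nbr lu].
  by rewrite -{2}lu mem_last andbF.
apply: (acyE c size_c); rewrite /ucycle uniq_c andbT.
apply: (sub_in_cycle (P := predC1 v)) cyc => [x y /= xv yv|].
  by case/E'P=> // -[xE yE]; move: xv yv; rewrite !inE xE yE eqxx.
by apply/allP=> x xc /=; apply: contraNneq vc => <-.
Qed.

(** Follow a shortest lattice path from [u] to [v]: a new vertex is attached as a leaf for one edge,
    and a vertex already in the tree costs nothing. *)
Lemma grid_tree_walk {V E u} v :
  grid_tree V E -> u \in V ->
  exists V' E', [/\ grid_tree V' E', {subset V <= V'}, v \in V' &
    (#|` E'|%fset)%:Z <= (#|` E|%fset)%:Z + l1dist u v].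
Proof.
have [n] := ubnP `|l1dist u v|%N.
elim: n V E u => // n IH V E u; rewrite ltnS => len tVE uV.
have [->|uv] := eqVneq v u; first by exists V, E; split=> //; rewrite /l1dist; lia.
have [w [adj_uw wv]] : exists w, grid_adj u w /\ l1dist u v = l1dist w v + 1.
  case: u v uv {IH len tVE uV} => [a b] [a' b'] uv; rewrite /grid_adj /l1dist /=.
  have [aa'|aa'|aa'] := ltgtP a a'.
  - by exists (a + 1, b) => /=; lia.
  - by exists (a - 1, b) => /=; lia.
  rewrite aa' in uv *; have [bb'|bb'|bb'] := ltgtP b b'.
  - by exists (a', b + 1) => /=; lia.
  - by exists (a', b - 1) => /=; lia.
  by rewrite bb' eqxx in uv.
have [V1 [E1 [t1 s1 w1 e1]]] : exists V1 E1, [/\ grid_tree V1 E1,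
    {subset V <= V1}, w \in V1 & (#|` E1|%fset <= #|` E|%fset + 1)%N].
  have [wV|wV] := boolP (w \in V); first by exists V, E; split; rewrite ?leq_addr.
  exists (w |` V)%fset, ([fset u; w] |` E)%fset.
  split; [exact: grid_tree_leaf | by move=> x xV; apply: fset1Ur | exact: fset1U1 |].
  by rewrite cardfsU1; lia.
have [|V2 [E2 [t2 s2 v2 e2]]] := IH V1 E1 w _ t1 w1.
  by move: len wv; rewrite /l1dist; lia.
by exists V2, E2; split=> [//|x /s1/s2//|//|]; lia.
Qed.

(** The tree grows from the single vertex [m] by three walks, each starting again at [m]. *)
Lemma tristance_le (m z1 z2 z3 : vertex) :
  (tristance z1 z2 z3)%:Z <= l1dist m z1 + l1dist m z2 + l1dist m z3.
Proof.
have [V1 [E1 [t1 s1 v1 e1]]] := grid_tree_walk z1 (grid_tree1 m) (fset11 m).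
have [V2 [E2 [t2 s2 v2 e2]]] := grid_tree_walk z2 t1 (s1 m (fset11 m)).
have [V3 [E3 [t3 s3 v3 e3]]] := grid_tree_walk z3 t2 (s2 m (s1 m (fset11 m))).
rewrite /tristance; case: ex_minnP => n _ /(_ #|` E3|%fset) min_n.
suff : (n <= #|` E3|%fset)%N by move: e1; rewrite cardfs0; lia.
by apply: min_n; apply/asboolP; exists V3, E3; split=> //; [apply/s3/s2 | apply/s3].
Qed.

Definition crosses (f : vertex -> int) (k : int) (e : {fset vertex}) : Prop :=
  exists a b, [/\ e = [fset a; b]%fset, grid_adj a b, f a = k & f b = k + 1].

(** Discrete intermediate value: on the step to the first vertex with [f] above [k], a change of at
    most 1 must go from [k] to [k + 1]. *)
Lemma path_crosses V E (f : vertex -> int) (k : int) (u : vertex) p :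
  grid_subgraph V E -> (forall a b, grid_adj a b -> `|f b - f a| <= 1) ->
  path (edge_rel E) u p -> f u <= k < f (last u p) ->
  exists2 e, e \in E & crosses f k e.
Proof.
move=> subE lipf; elim: p u => [|w p IH] u /=; first by lia.
move=> /andP[uwE pE] fu; have [wk|kw] := lerP (f w) k.
  by apply: IH pE _; rewrite wk; case/andP: fu.
have uw : grid_adj u w.
  case/subE: uwE => a [b [_ _ ab /fset2_inj[[-> ->//]|[-> ->]]]].
  by move: ab; rewrite /grid_adj /l1dist; lia.
exists [fset u; w]%fset => //; exists u, w; split=> //; have := lipf _ _ uw; lia.
Qed.

Lemma leq_card_choice (I : finType) (T : choiceType) (E : {fset T})
    (P : I -> T -> Prop) :
  (forall i, exists2 e, e \in E & P i e) ->
  (forall i j e, P i e -> P j e -> i = j) -> (#|I| <= #|` E|%fset)%N.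
Proof.
move=> exP injP; have /choice[g gP] : forall i, exists e : E, P i (val e).
  by move=> i; have [e eE Pe] := exP i; exists [` eE]%fset.
rewrite cardfE; apply: (@leq_card _ _ g) => i j gij.
by apply: injP (gP i) _; rewrite gij.
Qed.

Lemma connected_width_height V E (u v w t : vertex) :
  grid_subgraph V E -> connected_graph V E ->
  u \in V -> v \in V -> w \in V -> t \in V ->
  v.1 - u.1 + (t.2 - w.2) <= (#|` E|%fset)%:Z.
Proof.
move=> subE conE uV vV wV tV.
(* No order on the points is assumed: a negative extent is cut off at 0 and its family of lines is
   empty. *)
pose n := `|Num.max 0%R (v.1 - u.1)%R|%N; pose m := `|Num.max 0%R (t.2 - w.2)%R|%N.
pose P (i : 'I_n + 'I_m) := match i with
  | inl i => crosses fst (u.1 + i%:Z)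
  | inr j => crosses snd (w.2 + j%:Z) end.
suff : (#|{: 'I_n + 'I_m}| <= #|` E|%fset)%N.
  by rewrite card_sum !card_ord /n /m; lia.
apply: (leq_card_choice _ _ E P) => [[i|j]|i j e].
- have [p pE lp] := conE u v uV vV.
  apply: path_crosses subE _ pE _; first by rewrite /grid_adj /l1dist; lia.
  by rewrite lp; have := ltn_ord i; rewrite {2}/n; lia.
- have [p pE lp] := conE w t wV tV.
  apply: path_crosses subE _ pE _; first by rewrite /grid_adj /l1dist; lia.
  by rewrite lp; have := ltn_ord j; rewrite {2}/m; lia.
(* A grid edge changes one coordinate only, by 1, so it determines both the direction and the index
   of the line it crosses. *)
by case: i j => i [] j /= [a [b [-> + fa fb]]]
    [a' [b' [/fset2_inj[[? ?]|[? ?]] + fa' fb']]];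
  subst; rewrite /grid_adj /l1dist => ? ?;
  try (congr (_ _); apply: val_inj => /=); lia.
Qed.

(** Choosing [u], [v], [w], [t] extremal gives half the perimeter of the bounding box; leaving them
    free avoids a case analysis on which points are extremal. *)
Lemma tristance_ge {z1 z2 z3 u v w t : vertex} :
  u \in [:: z1; z2; z3] -> v \in [:: z1; z2; z3] ->
  w \in [:: z1; z2; z3] -> t \in [:: z1; z2; z3] ->
  v.1 - u.1 + (t.2 - w.2) <= (tristance z1 z2 z3)%:Z.
Proof.
rewrite /tristance; case: ex_minnP => n /asboolP + _.
move=> [V [E [[subE conE _] z1V z2V z3V <-]]].
have inV z : z \in [:: z1; z2; z3] -> z \in V by rewrite !inE => /or3P[]/eqP->.
by move=> /inV uV /inV vV /inV wV /inV tV; apply: (connected_width_height V).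
Qed.

Lemma finite_int_range (a b : int) : finite_set [set k : int | a <= k <= b].
Proof.
have := finite_image (fun i : nat => a + i%:Z) (finite_II `|b - a|.+1).
apply: sub_finite_set => k /= akb; exists `|k - a|%N => /=; lia.
Qed.

(** Finiteness turns the comparison by injections into one of natural numbers; this gives uniqueness
    of the optimal anticode. *)
Lemma card_le_subset_eq (T : choiceType) (A B : set T) :
  finite_set B -> A `<=` B -> (B #<= A)%card -> A = B.
Proof.
move=> finB AB leBA; have finA := sub_finite_set AB finB.
suff eqAB : fset_set A = fset_set B by rewrite -(fset_setK finA) eqAB fset_setK.
apply/eqP; rewrite eqEfcard; apply/andP; split; first by rewrite -fset_set_sub.
apply: geq_card_fset_set; apply: card_le_trans leBA _.
have /card_eq_fsetP : #|` fset_set A|%fset = #|` fset_set A|%fset by [].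
by rewrite fset_setK // card_eq_le => /andP[].
Qed.

Theorem theorem8 (x1 y1 x2 y2 d c : int) (A : set vertex)
    (z12 : (x1, y1) <> (x2, y2)) (x12 : x1 <= x2) (y12 : y1 <= y2)
    (dd : l1dist (x1, y1) (x2, y2) <= d)
    (cE : c = d - l1dist (x1, y1) (x2, y2)) :
  optimal_anticode (x1, y1) (x2, y2) d A <->
  A = [set z : vertex |
        [/\ x1 - c <= z.1 <= x2 + c,
            y1 - c <= z.2 <= y2 + c,
            x1 + y1 - c <= z.1 + z.2 <= x2 + y2 + c &
            x1 - y2 - c <= z.1 - z.2 <= x2 - y1 + c]].
Proof.
set S := [set z | _].
have SE z : S z <-> (tristance (x1, y1) (x2, y2) z)%:Z <= d.
  move: dd cE; rewrite /l1dist /= => dd cE; split=> [[zx zy zs zd]|le_d].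
    (* [m] is the point of the box nearest to [z]. Its distances to the two centers add up to the
       distance between them, and the inequalities of [S] put [z] within [c] of it. *)
    pose m : vertex := (Num.max x1 (Num.min z.1 x2), Num.max y1 (Num.min z.2 y2)).
    by apply: le_trans (tristance_le m _ _ _) _; rewrite /l1dist /m /=; lia.
  have [m1 m2 m3] : let s := [:: (x1, y1); (x2, y2); z] in
      [/\ (x1, y1) \in s, (x2, y2) \in s & z \in s] by split; rewrite !inE eqxx ?orbT.
  (* Each of the eight instances yields one of the eight bounds defining [S], in the order of the
     statement. *)
  move: (tristance_ge m3 m2 m1 m2) (tristance_ge m1 m3 m1 m2)
        (tristance_ge m1 m2 m3 m2) (tristance_ge m1 m2 m1 m3)
        (tristance_ge m3 m2 m3 m2) (tristance_ge m1 m3 m1 m3)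
        (tristance_ge m3 m2 m1 m3) (tristance_ge m1 m3 m3 m2).
  by rewrite /=; split; lia.
have finS : finite_set S.
  apply: sub_finite_set (finite_setX (finite_int_range (x1 - c) (x2 + c))
                                     (finite_int_range (y1 - c) (y2 + c))).
  by move=> z [].
have codeS B : tristance_anticode (x1, y1) (x2, y2) d B <-> B `<=` S.
  by split=> BS z /BS /SE.
split=> [[/codeS AS]|->]; last first.
  by split=> [|B /codeS/subset_card_le//]; exact/codeS.
(* [S] is itself an anticode, so an optimal [A] inside [S] is at least as large as [S]. *)
by move=> /(_ S) leSA; apply: card_le_subset_eq AS (leSA _) => //; exact/codeS.
Qed.
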